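(* Let $n,k$ be positive integers with \[ \frac{n}{W(n)}\leqslant k\leqslant \frac{2n}{\log n+6} \] (equivalently $1\leqslant\lambda\leqslant\frac{2}{e^3}\cdot\frac{\sqrt n}{\log n+6}$). Then for any fixed integer $s_1\geqslant 1$, \[ S(n,k)=\left(1-\frac{\lambda}{k}\right)^k\left(1+\sum_{2\leqslant m<2s_1}\frac{\tau_m(n)}{m!\,k^m}\,\bar Q_{n,k}(m)+O\left(\left(\frac{\lambda\log n}{\sqrt n}\right)^{2s_1}\right)\right), \] where \[ \bar Q_{n,k}(m)=\sum_{0\leqslant j\leqslant m}\binom{k}{j}\left\{ m \atop j\right\} j!\,(-\Lambda)^j . \]
   Context: $\left\{ m \atop j\right\}$ denotes Stirling numbers of the second kind, and $S(n,k):=\left\{ n \atop k\right\}\frac{k!}{k^n}=\sum_{0\leqslant j\leqslant k}\binom{k}{j}(-1)^j\left(1-\frac jk\right)^n$. Put $\lambda:=ke^{-n/k}$ and $\Lambda:=\frac{\lambda}{k-\lambda}$. The polynomials $\tau_m(n)$ are defined by the Taylor expansion $(e^x(1-x))^n=\sum_{m\geqslant 0}\frac{\tau_m(n)}{m!}x^m$. $W$ is the principal branch of the Lambert $W$-function; $\log$ is natural. *)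

(* Defs.v *)
(* MathComp / MathComp-Analysis. *)
From mathcomp Require Import all_boot all_order all_algebra.
From mathcomp Require Import all_classical all_reals all_analysis.

Set Implicit Arguments.
Unset Strict Implicit.
Unset Printing Implicit Defensive.

Import Order.TTheory GRing.Theory Num.Theory.
Import numFieldNormedType.Exports.

Local Open Scope ring_scope.

(* The qualified name is needed: classical_sets also defines a [partition].
   [finset.partition] requires nonempty blocks, and gives stirling2 0 0 = 1. *)
Definition stirling2 (m j : nat) : nat :=
  #|[set P : {set {set 'I_m}} | finset.partition P [set: 'I_m] & #|P| == j]|.

Definition Snk (R : realType) (n k : nat) : R :=
  (stirling2 n k)%:R * (k`!)%:R / k%:R ^+ n.

(* Principal branch: w * e^w is injective on [-1, +oo[, so the solution is
   unique there; it exists exactly for x >= -1/e, and 0 is a junk value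
   elsewhere. *)
Definition lambertW (R : realType) (x : R) : R :=
  xget 0 [set w : R | -1 <= w /\ w * expR w = x]%classic.

Definition lambda (R : realType) (n k : nat) : R :=
  k%:R * expR (- (n%:R / k%:R)).

Definition Lambda (R : realType) (n k : nat) : R :=
  lambda R n k / (k%:R - lambda R n k).

(* m! times the coefficient of x^m in the Taylor expansion at 0 of
   (e^x (1 - x))^n, i.e. the m-th derivative of that function at 0. *)
Definition tau (R : realType) (m n : nat) : R :=
  derive1n m (fun x : R => (expR x * (1 - x)) ^+ n) 0.

Definition Qbar (R : realType) (n k m : nat) : R :=
  \sum_(0 <= j < m.+1)
    'C(k, j)%:R * (stirling2 m j)%:R * (j`!)%:R * (- Lambda R n k) ^+ j.

(* Main.v *)
(** Put [f(x) = (e^x (1 - x))^n] and [q = lambda / k = e^(-n/k)].  Inclusion-exclusion reads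
    [S(n,k) = \sum_j C(k,j) (-q)^j f(j/k)], and replacing [f] by its Taylor polynomial of
    degree [< M] turns the sum into [(1 - q)^k \sum_(m < M) tau_m(n) / (m! k^m) Qbar(m)],
    since [\sum_j C(k,j) p^j j^m] can be expanded with Stirling numbers for any [p].

    Cancellation in the sum over [j] is worth a factor [e^(-O(lambda))], and
    [lambda <= sqrt n].  Hence [M] is taken of order [sqrt n]: the remainder, of size
    [(O(1) log n / n^(1/4))^M], then survives the triangle inequality over [j], and only the
    terms [2 s1 <= m < M] have to be estimated with cancellation, i.e. through [Qbar].  The
    coefficients of [f] are at most [(e sqrt (n/m))^m] because those of [e^x (1 - x)] have
    weighted sum at most [1 + r^2] at radius [r <= 1]; [Qbar(m)] is at most
    [(O(1) (m + 2 lambda))^m] by the Stirling expansion at a positive [p].  With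
    [1/k <= log n / n] the m-th term is at most
    [(O(1) (sqrt m log n / sqrt n + lambda log n / (sqrt (n m))))^m], which is geometrically
    small beyond a fixed [m].  The finitely many small [n] are absorbed in the constant. *)

Require Import Defs.
From mathcomp Require Import all_boot all_order all_algebra.
From mathcomp Require Import all_classical all_reals all_analysis.
From mathcomp Require Import ring lra.

Import Order.TTheory GRing.Theory Num.Theory.
Import numFieldNormedType.Exports.

Local Open Scope ring_scope.

(** * Stirling numbers of the second kind *)

(** A function whose fibres are exactly the blocks of [P] is an injection from the blocks into [U]
    composed with [x |-> block of x]. This composition, [phi], is injective because every block is
    nonempty and so has a representative. *)
Lemma card_ffun_kernel (T U : finType) (P : {set {set T}}) :
  finset.partition P [set: T] ->
  #|[set f : {ffun T -> U} | finset.preim_partition f [set: T] == P]|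
    = (#|U| ^_ #|P|)%N.
Proof.
move=> partP; have /and3P[/eqP covP tiP P0] := partP.
have Pblk x : finset.pblock P x \in P by rewrite finset.pblock_mem// covP inE.
pose D : finType := {B : {set T} | B \in P}.
pose blk x : D := exist _ (finset.pblock P x) (Pblk x).
have blk_eq x y : (blk x == blk y) = (y \in finset.pblock P x).
  by rewrite -val_eqE /= finset.eq_pblock// covP inE.
have rep (B : D) : {x | blk x = B}.
  case: B => B PB; case: (pickP [in B]) => [x xB|B0].
    by exists x; apply: val_inj; rewrite /= (finset.def_pblock tiP PB xB).
  suff B_0 : B = finset.set0 by rewrite -B_0 PB in P0.
  by apply/setP => x; rewrite inE; exact: B0.
pose phi (g : {ffun D -> U}) : {ffun T -> U} := [ffun x => g (blk x)].
have phi_inj : injective phi.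
  move=> g h /ffunP e; apply/ffunP => B; have [x <-] := rep B.
  by have := e x; rewrite !ffunE.
have -> : #|P| = #|D| by rewrite card_sig; apply: eq_card => B; rewrite !inE.
rewrite -card_inj_ffuns -(card_imset _ phi_inj); apply: eq_card => f.
rewrite inE; apply/idP/imsetP => [/eqP kerf|[g]].
  have ker x y : (f x == f y) = (blk x == blk y).
    rewrite blk_eq -[in RHS]kerf /finset.preim_partition finset.pblock_equivalence_partition//.
    by split=> // /eqP->.
  exists [ffun B : D => f (sval (rep B))].
    rewrite inE; apply/injectiveP => B C; rewrite !ffunE => /eqP.
    by rewrite ker (svalP (rep B)) (svalP (rep C)) => /eqP.
  apply/ffunP => x; rewrite !ffunE; apply/eqP.
  by rewrite ker (svalP (rep (blk x))).
rewrite inE => /injectiveP ginj ->.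
rewrite -[X in _ == X](finset.equivalence_partition_pblock partP).
apply/eqP; rewrite /finset.preim_partition /finset.equivalence_partition.
apply: eq_imset => x; apply/setP => y.
by rewrite !inE /= !ffunE (inj_eq ginj) blk_eq.
Qed.

Lemma card_partition_leq (T : finType) (P : {set {set T}}) :
  finset.partition P [set: T] -> (#|P| <= #|T|)%N.
Proof.
move=> partP; rewrite -cardsT (finset.card_partition partP) -sum1_card.
apply: leq_sum => B PB; rewrite card_gt0; apply: contraTneq PB => ->.
by have /and3P[] := partP.
Qed.

(** Counts all maps from [m] points to [j] points, sorted first by their kernel partition and then
    by its number of blocks. *)
Lemma expn_stirling2 (j m : nat) :
  (j ^ m = \sum_(i < m.+1) stirling2 m i * j ^_ i)%N.
Proof.
have -> : (j ^ m = #|{: {ffun 'I_m -> 'I_j}}|)%N by rewrite card_ffun !card_ord.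
rewrite -sum1_card.
rewrite (partition_big (fun f : {ffun 'I_m -> 'I_j} => finset.preim_partition f [set: 'I_m])
  (fun P : {set {set 'I_m}} => finset.partition P [set: 'I_m])); last first.
  by move=> f _; apply: (@finset.preim_partitionP _ _ f).
transitivity (\sum_(P : {set {set 'I_m}} | finset.partition P [set: 'I_m]) j ^_ #|P|)%N.
  apply: eq_bigr => P partP; rewrite sum1dep_card -[in RHS](card_ord j).
  exact: card_ffun_kernel.
(* [inord] would send a value above [m] to a default; a partition of [m] points has at most [m]
   blocks, so the label is faithful. *)
rewrite (partition_big (fun P : {set {set 'I_m}} => inord #|P| : 'I_m.+1) predT)//=.
apply: eq_bigr => i _.
rewrite /stirling2 -sum1dep_card big_distrl/=.
have val_card (P : {set {set 'I_m}}) : finset.partition P [set: 'I_m] ->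
    (inord #|P| : 'I_m.+1) = #|P| :> nat.
  by move=> pP; apply: inordK; rewrite ltnS -[X in (_ <= X)%N]card_ord card_partition_leq.

rewrite (eq_bigl (fun P : {set {set 'I_m}} =>
    finset.partition P [set: 'I_m] && (#|P| == i))) => [|P].
  by apply: eq_bigr => P /andP[_ /eqP ->]; rewrite mul1n.
by case: (boolP (finset.partition _ _)) => //= pP; rewrite -val_eqE /= val_card.
Qed.

Lemma natX_stirling2 (R : pzRingType) (j m : nat) :
  j%:R ^+ m = \sum_(0 <= i < m.+1)
    (stirling2 m i)%:R * (i`!)%:R * 'C(j, i)%:R :> R.
Proof.
rewrite -natrX expn_stirling2 natr_sum big_mkord; apply: eq_bigr => i _.
by rewrite -!natrM -mulnA -bin_ffact (mulnC i`!).
Qed.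

(** Pascal's rule on both binomials. This recursion in [k] yields the closed form for [1 + p != 0]
    as well as the degenerate one at [p = -1]. *)
Lemma sum_bin_binS (R : comNzRingType) (k i : nat) (p : R) :
  \sum_(j < k.+2) 'C(k.+1, j)%:R * 'C(j, i.+1)%:R * p ^+ j =
  (1 + p) * \sum_(j < k.+1) 'C(k, j)%:R * 'C(j, i.+1)%:R * p ^+ j
  + p * \sum_(j < k.+1) 'C(k, j)%:R * 'C(j, i)%:R * p ^+ j.
Proof.
rewrite big_ord_recl bin0n mulr0 mul0r add0r.
rewrite (eq_bigr (fun j : 'I_k.+1 =>
    'C(k, j.+1)%:R * 'C(j.+1, i.+1)%:R * p ^+ j.+1 +
    (p * ('C(k, j)%:R * 'C(j, i.+1)%:R * p ^+ j) +
     p * ('C(k, j)%:R * 'C(j, i)%:R * p ^+ j)))) => [|j _]; last first.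
  by rewrite !lift0 !binS !natrD exprS; ring.
rewrite !big_split /= -!mulr_sumr mulrDl mul1r addrA; congr (_ + _ + _).
rewrite [RHS]big_ord_recl bin0n mulr0 mul0r add0r big_ord_recr /=.
rewrite bin_small// !mul0r addr0.
by apply: eq_bigr => j _; rewrite /bump /= add1n.
Qed.

Lemma sum_bin0 (R : comNzRingType) (k : nat) (p : R) :
  \sum_(j < k.+1) 'C(k, j)%:R * 'C(j, 0)%:R * p ^+ j = (1 + p) ^+ k.
Proof.
rewrite exprDn; apply: eq_bigr => j _.
by rewrite bin0 mulr1 expr1n mul1r mulr_natl.
Qed.

(** The binomial theorem differentiated [i] times in [p]. Writing [(p / (1 + p)) ^+ i] avoids the
    exponent [k - i], so [i > k] needs no separate treatment. *)
Lemma sum_bin_bin (F : fieldType) (k i : nat) (p : F) : 1 + p != 0 ->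
  \sum_(j < k.+1) 'C(k, j)%:R * 'C(j, i)%:R * p ^+ j =
  (1 + p) ^+ k * 'C(k, i)%:R * (p / (1 + p)) ^+ i.
Proof.
move=> p1; elim: k i => [|k IH] [|i]; rewrite ?sum_bin0 ?bin0 ?expr0 ?mulr1//.
  by rewrite big_ord1 !bin0n /= !(mulr0, mul0r).
rewrite sum_bin_binS !IH binS natrD !exprS.
by field.
Qed.

Lemma sum_bin_binN1 (R : comNzRingType) (k i : nat) :
  \sum_(j < k.+1) 'C(k, j)%:R * 'C(j, i)%:R * (-1) ^+ j =
  (-1) ^+ k * (i == k)%:R :> R.
Proof.
elim: k i => [|k IH] [|i].
- by rewrite big_ord1 bin0 !mulr1.
- by rewrite big_ord1 !bin0n /= !(mulr0, mul0r).
- by rewrite sum_bin0 subrr expr0n mulr0.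
- by rewrite sum_bin_binS !IH subrr mul0r add0r eqSS exprS mulrA.
Qed.

(** Used in both directions: at [p = - lambda / k] the right-hand sum is [Qbar], while at a positive
    [p] it converts a Stirling sum into a binomial sum of nonnegative terms. *)
Lemma sum_bin_natX (F : fieldType) (k m : nat) (p : F) : 1 + p != 0 ->
  \sum_(j < k.+1) 'C(k, j)%:R * p ^+ j * j%:R ^+ m =
  (1 + p) ^+ k * \sum_(0 <= i < m.+1)
    'C(k, i)%:R * (stirling2 m i)%:R * (i`!)%:R * (p / (1 + p)) ^+ i.
Proof.
move=> p1; under eq_bigr => j _ do rewrite natX_stirling2 mulr_sumr.
rewrite exchange_big /= mulr_sumr; apply: eq_bigr => i _.
transitivity ((stirling2 m i)%:R * (i`!)%:R * ((1 + p) ^+ k * 'C(k, i)%:R * (p / (1 + p)) ^+ i)).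
  rewrite -sum_bin_bin// mulr_sumr; apply: eq_bigr => j _; ring.
ring.
Qed.

(** Inclusion-exclusion for surjections, obtained by inverting the Stirling expansion of [j ^ n]: at
    [p = -1] only the index [i = k] survives, and [k <= n] ensures that it occurs. *)
Lemma stirling2_fact (R : comNzRingType) (n k : nat) : (k <= n)%N ->
  (stirling2 n k)%:R * (k`!)%:R =
  (-1) ^+ k * \sum_(j < k.+1) 'C(k, j)%:R * (-1) ^+ j * j%:R ^+ n :> R.
Proof.
move=> kn; under eq_bigr => j _ do rewrite natX_stirling2 mulr_sumr.
rewrite exchange_big /=.
transitivity ((-1) ^+ k * \sum_(0 <= i < n.+1)
    (stirling2 n i)%:R * (i`!)%:R * ((-1) ^+ k * (i == k)%:R) : R).
  rewrite (bigD1_seq k) ?iota_uniq//=; last first.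
    by rewrite mem_index_iota.
  rewrite big1 => [|i /negPf ->]; last by rewrite !mulr0.
  by rewrite eqxx mulr1 addr0 mulrCA -expr2 sqrr_sign mulr1.
congr (_ * _); apply: eq_bigr => i _.
rewrite -sum_bin_binN1 mulr_sumr; apply: eq_bigr => j _; ring.
Qed.

Lemma Snk_sum (R : realType) (n k : nat) : (0 < k)%N -> (k <= n)%N ->
  Snk R n k =
  \sum_(j < k.+1) 'C(k, j)%:R * (-1) ^+ j * (1 - j%:R / k%:R) ^+ n.
Proof.
move=> k0 kn; have kN0 : k%:R != 0 :> R by rewrite pnatr_eq0 -lt0n.
(* The reversal [j |-> k - j] turns [(j / k) ^ n] into [(1 - j / k) ^ n]; the signs recombine
   through [e * e = 1] below. *)
rewrite /Snk stirling2_fact// (reindex_inj rev_ord_inj)/= mulr_sumr mulr_suml.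
rewrite [LHS](_ : _ = \sum_(j < k.+1) (-1) ^+ k * ('C(k, k.+1 - j.+1)%:R
  * (-1) ^+ (k.+1 - j.+1) * (k.+1 - j.+1)%N%:R ^+ n) / k%:R ^+ n); last first.
  by apply: eq_bigr => j _; ring.
apply: eq_bigr => j _; have jk : (j <= k)%N by rewrite -ltnS.
rewrite subSS bin_sub// -[X in (-1) ^+ X * _](subnK jk) exprD natrB//.
rewrite (_ : 1 - _ = (k%:R - j%:R) / k%:R); last by field.
rewrite expr_div_n; set e := (-1) ^+ (k - j).
have ee : e * e = 1 by rewrite -expr2 sqrr_sign.
transitivity (e * e * ('C(k, j)%:R * (-1) ^+ j * ((k%:R - j%:R) ^+ n / k%:R ^+ n))).
  ring.
by rewrite ee mul1r.
Qed.

Lemma Qbar_sum (R : realType) (n k m : nat) : lambda R n k < k%:R ->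
  \sum_(j < k.+1) 'C(k, j)%:R * (- (lambda R n k / k%:R)) ^+ j * j%:R ^+ m =
  (1 - lambda R n k / k%:R) ^+ k * Qbar R n k m.
Proof.
move=> lk; have k0 : (0 : R) < k%:R.
  by rewrite (le_lt_trans _ lk)// mulr_ge0// expR_ge0.
have kl : k%:R - lambda R n k != 0 by rewrite subr_eq0 gt_eqF.
rewrite sum_bin_natX; last by rewrite subr_eq0 eq_sym lt_eqF// ltr_pdivrMr// mul1r.
congr (_ * _); apply: eq_bigr => i _; congr (_ * _ ^+ _); rewrite /Lambda.
by field; rewrite kl gt_eqF.
Qed.

(** * Exponential bounds *)

Lemma leq_fact_add (j l : nat) : (j`! <= (j + l)`!)%N.
Proof.
elim: l => [|l IH]; first by rewrite addn0.
by rewrite addnS factS (leq_trans IH)// leq_pmull.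
Qed.

Lemma expR_series_ge (R : realType) (x : R) (N : nat) : 0 <= x ->
  \sum_(0 <= j < N) x ^+ j / (j`!)%:R <= expR x.
Proof.
move=> x0; apply: (nondecreasing_cvgn_le _ (is_cvg_series_exp_coeff x) N).
by apply: nondecreasing_series => j _ _; exact: exp_coeff_ge0.
Qed.

(** Termwise, [x^(N+j) / (N+j)! <= x^N * x^j / j!]. *)
Lemma expR_series_tail (R : realType) (x : R) (N : nat) : 0 <= x ->
  expR x - \sum_(0 <= j < N) x ^+ j / (j`!)%:R <= x ^+ N * expR x.
Proof.
move=> x0; rewrite lerBlDr; apply: limr_le; first exact: is_cvg_series_exp_coeff.
near=> M; have NM : (N <= M)%N by near: M; exists N.
rewrite /series/= (@big_cat_nat _ _ _ N)//= addrC lerD2r -{1}(add0n N) big_addn.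
apply: (@le_trans _ _ (x ^+ N * \sum_(0 <= j < M - N) x ^+ j / (j`!)%:R)).
  rewrite mulr_sumr; apply: ler_sum => j _.
  rewrite /exp_coeff/= exprD mulrA [x ^+ N * _]mulrC ler_wpM2l//.
    by rewrite mulr_ge0// exprn_ge0.
  rewrite lef_pV2 ?posrE ?ltr0n ?fact_gt0// ler_nat.
  exact: leq_fact_add.
by rewrite ler_wpM2l ?exprn_ge0// expR_series_ge.
Unshelve. all: by end_near. Qed.

Lemma exprn_le_fact_expR (R : realType) (x : R) (m : nat) : 0 <= x ->
  x ^+ m <= (m`!)%:R * expR x.
Proof.
move=> x0; rewrite mulrC -ler_pdivrMr ?ltr0n ?fact_gt0//.
apply: le_trans (expR_series_ge _ _ m.+1 x0); rewrite big_nat_recr//= lerDr.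
by apply: sumr_ge0 => j _; rewrite divr_ge0// exprn_ge0.
Qed.

Lemma fact_le_expn (m : nat) : (m`! <= m ^ m)%N.
Proof.
elim: m => // m IH; rewrite factS expnS leq_mul2l /= (leq_trans IH)//.
by case: m {IH} => // m; rewrite leq_exp2r.
Qed.

Lemma exprn_1D_le_expR (R : realType) (x : R) (n : nat) : 0 <= 1 + x ->
  (1 + x) ^+ n <= expR (n%:R * x).
Proof. by move=> x1; rewrite expRM_natl lerXn2r ?nnegrE ?expR_ge0// expR_ge1Dx. Qed.

(** From [(rho j)^m <= m! e^(rho j)] and the binomial theorem; [rho] is left free for later
    optimization. *)
Lemma sum_bin_natX_le (R : realType) (k m : nat) (p rho : R) :
  0 <= p -> 0 < rho ->
  \sum_(j < k.+1) 'C(k, j)%:R * p ^+ j * j%:R ^+ m <=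
  (m`!)%:R / rho ^+ m * (1 + p * expR rho) ^+ k.
Proof.
move=> p0 r0; rewrite addrC exprD1n mulr_sumr; apply: ler_sum => j _.
rewrite exprMn -expRM_natl.
have : (rho * j%:R) ^+ m <= (m`!)%:R * expR (j%:R * rho).
  by rewrite mulrC exprn_le_fact_expR// mulr_ge0// ltW.
rewrite exprMn mulrC -ler_pdivlMr ?exprn_gt0// => le_m.
rewrite [leRHS](_ : _ = 'C(k, j)%:R * p ^+ j *
    ((m`!)%:R * expR (j%:R * rho) / rho ^+ m)); last by ring.
by rewrite ler_wpM2l// mulr_ge0// exprn_ge0.
Qed.

Lemma sum_bin_stirling2_le (R : realType) (k m : nat) (t rho : R) :
  0 <= t < 1 -> 0 < rho ->
  \sum_(0 <= i < m.+1) 'C(k, i)%:R * (stirling2 m i)%:R * (i`!)%:R * t ^+ i <=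
  (m`!)%:R / rho ^+ m * expR (k%:R * (t * (expR rho - 1))).
Proof.
(* [p] is chosen with [p / (1 + p) = t], which turns the Stirling sum back into
   a binomial sum with positive terms. *)
move=> /andP[t0 t1] r0; pose p := t / (1 - t).
have tN1 : 0 < 1 - t by rewrite subr_gt0.
have p0 : 0 <= p by rewrite divr_ge0// ltW.
have p1 : 1 + p = (1 - t)^-1 by rewrite /p; field; rewrite gt_eqF.
have pt : p / (1 + p) = t by rewrite p1 invrK /p divfK// gt_eqF.
have p1_gt0 : 0 < 1 + p by rewrite p1 invr_gt0.
have := sum_bin_natX_le _ k m _ _ p0 r0.
rewrite sum_bin_natX ?gt_eqF// pt -ler_pdivlMl ?exprn_gt0// => /le_trans; apply.
rewrite mulrCA -(exprVn (1 + p)) -exprMn p1 invrK ler_wpM2l ?divr_ge0 ?exprn_ge0//.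
  exact: ltW.
rewrite (_ : (1 - t) * _ = 1 + t * (expR rho - 1)); last first.
  by rewrite /p; field; rewrite gt_eqF.
by rewrite exprn_1D_le_expR// addr_ge0// mulr_ge0// subr_ge0 ltW// pexpR_gt1.
Qed.

(** * Taylor coefficients of (e^x (1 - x))^n *)

(** Differentiation conjugated by [e^(a x)] acts on polynomials as [q |-> a q + q'], which makes
    [tau] a purely algebraic quantity. *)
Lemma derive1n_expR_poly (R : realType) (a : R) (p : {poly R}) (m : nat) :
  derive1n m (fun x => expR (a * x) * p.[x]) =
  fun x => expR (a * x) * (iter m (fun q => a *: q + q^`()%R) p).[x].
Proof.
elim: m => [//|m IH]; rewrite derive1nS IH iterS; set q := iter m _ p.
apply/funext => x; rewrite derive1E.
have dexp : is_derive x 1 (fun y => expR (a * y)) (a * expR (a * x)).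
  have dlin : is_derive x (1 : R) (fun y : R => a * y) a.
    have := @is_deriveZ _ _ _ id a x 1 1 (is_derive_id _ _).
    by rewrite /GRing.scale/= mulr1.
  have := @is_derive1_comp _ expR (fun y => a * y) x _ _ (is_derive_expR _) dlin.
  by rewrite mulrC.
have := @is_deriveM _ _ (fun y => expR (a * y)) (horner q) x 1 _ _ dexp (is_derive_poly q x).
move=> /@derive_val; rewrite /GRing.scale/= => h.
rewrite [LHS]h hornerD hornerZ; ring.
Qed.

(* Applied to the operators [p |-> a p + p'], i.e. to differentiation conjugated by
   [e^(a x)], which satisfy this product rule for the exponents [a + b], [a], [b]. *)
Lemma iter_Leibniz (R : comNzRingType) (d d1 d2 : {poly R} -> {poly R}) (m : nat) :
  (forall p q, d (p * q) = d1 p * q + p * d2 q) ->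
  {morph d : p q / p + q} -> forall p q,
  iter m d (p * q) =
  \sum_(i < m.+1) 'C(m, i)%:R * (iter i d1 p * iter (m - i) d2 q).
Proof.
move=> dM dD; elim: m => [|m IH] p q; first by rewrite big_ord1 bin0 mul1r.
have iterD r s : iter m d (r + s) = iter m d r + iter m d s.
  by elim: m {IH} => //= l ->; rewrite dD.
rewrite iterSr dM iterD !IH [RHS]big_ord_recl bin0 mul1r subn0 /=.
under [X in _ = _ + X]eq_bigr => i _ do
  rewrite /bump /= add1n binS natrD mulrDl subSS.
rewrite big_split /= addrA addrC; congr (_ + _).
  by apply: eq_bigr => i _; rewrite -iterSr.
rewrite big_ord_recl bin0 mul1r subn0 -iterSr; congr (_ + _).
rewrite [RHS]big_ord_recr /= bin_small// mul0r addr0; apply: eq_bigr => i _.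
by rewrite /bump /= add1n -iterSr -subSn ?subSS.
Qed.

Definition tcoef (R : realType) (n m : nat) : R := tau R m n / (m`!)%:R.

Lemma tau_iter (R : realType) (m n : nat) :
  tau R m n =
  (iter m (fun q : {poly R} => n%:R *: q + q^`()%R) ((1 - 'X) ^+ n)).[0].
Proof.
rewrite /tau; have -> : (fun x : R => (expR x * (1 - x)) ^+ n) =
    (fun x : R => expR (n%:R * x) * ((1 - 'X) ^+ n).[x]).
  by apply/funext => x; rewrite exprMn expRM_natl horner_exp !hornerE.
by rewrite derive1n_expR_poly mulr0 expR0 mul1r.
Qed.

Lemma tcoef0 (R : realType) (m : nat) : tcoef R 0 m = (m == 0)%:R.
Proof.
rewrite /tcoef tau_iter expr0; case: m => [|m]; first by rewrite hornerE divr1.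
rewrite iterSr scale0r add0r derivC.
suff -> : iter m (fun q : {poly R} => 0 *: q + q^`()%R) 0 = 0.
  by rewrite horner0 mul0r.
by elim: m => //= m ->; rewrite scaler0 deriv0 addr0.
Qed.

(** The Cauchy product with one more factor [e^x (1 - x)], whose [l]-th coefficient is
    [(1 - l) / l!]. *)
Lemma tcoefS (R : realType) (n m : nat) :
  tcoef R n.+1 m = \sum_(i < m.+1) tcoef R n i * ((1 - (m - i)%:R) / ((m - i)`!)%:R).
Proof.
have linear_iter l : iter l (fun q : {poly R} => 1 *: q + q^`()%R) (1 - 'X) =
    1 - 'X - l%:R%:P.
  elim: l => [|l IH]; first by rewrite subr0.
  rewrite iterS IH scale1r !poly.derivE -natr1 polyCD; ring.
rewrite /tcoef tau_iter exprSr.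
rewrite (@iter_Leibniz _ _ (fun q => n%:R *: q + q^`()%R) (fun q => 1 *: q + q^`()%R)).
- rewrite horner_sum mulr_suml; apply: eq_bigr => i _.
  have im : (i <= m)%N by rewrite -ltnS.
  rewrite linear_iter tau_iter hornerM hornerM !hornerE.
  rewrite -(bin_fact im) !natrM -polyC_natr !hornerE.
  have f0 l : (l`!)%:R != 0 :> R by rewrite pnatr_eq0 -lt0n fact_gt0.
  have b0 : 'C(m, i)%:R != 0 :> R by rewrite pnatr_eq0 -lt0n bin_gt0.
  rewrite /=; by field; rewrite b0 !f0.
- by move=> p q; rewrite derivM -natr1 scalerDl scale1r -!mul_polyC; ring.
- by move=> p q; rewrite derivD scalerDr addrACA.
Qed.

Lemma sum_conv (V : nmodType) (F : nat -> nat -> V) (N : nat) :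
  \sum_(m < N) \sum_(i < m.+1) F i (m - i)%N =
  \sum_(i < N) \sum_(l < N - i) F i l.
Proof.
elim: N => [|N IH]; first by rewrite !big_ord0.
rewrite big_ord_recr IH /= [RHS]big_ord_recr subSnn big_ord1 /=.
rewrite [X in _ + X]big_ord_recr /= subnn addrA -big_split; congr (_ + _).
by apply: eq_bigr => i _; rewrite subSn ?big_ord_recr// ltnW.
Qed.

(** The linear coefficient vanishes, and for [l >= 2] the absolute value
    [(l-1)/l! = 1/(l-1)! - 1/l!] telescopes to a total of at most 1, while [r^l <= r^2]. The missing
    linear term is what later gives [e^(n r^2)] instead of [e^(n r)]. *)
Lemma sum_coef1_le (R : realType) (r : R) (N : nat) : 0 <= r <= 1 ->
  \sum_(l < N) `|(1 - l%:R) / (l`!)%:R| * r ^+ l <= 1 + r ^+ 2.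
Proof.
move=> /andP[r0 r1].
have key M : \sum_(l < M.+2) `|(1 - l%:R) / (l`!)%:R| * r ^+ l <=
    1 + r ^+ 2 * (1 - ((M.+1)`!)%:R^-1).
  elim: M => [|M IH].
    rewrite !big_ord_recr big_ord0 /= fact0 subr0 subrr mul0r normr0 mul0r.
    by rewrite add0r addr0 expr0 divr1 normr1 mulr1 invr1 subrr mulr0 addr0.
  rewrite big_ord_recr /=.
  apply: (@le_trans _ _ (1 + r ^+ 2 * (1 - ((M.+1)`!)%:R^-1) +
      r ^+ 2 * (((M.+1)`!)%:R^-1 - ((M.+2)`!)%:R^-1))); last by lra.
  rewrite lerD// normrM -[X in `|1 - X|]natr1 opprD addrCA subrr addr0 normrN.
  rewrite normr_nat ger0_norm// mulrC -[X in r ^+ X]addn2 exprD mulrC.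
  have M1 : 0 < (M.+1`!)%:R :> R by rewrite ltr0n fact_gt0.
  have -> : M.+1%:R / (M.+2`!)%:R = (M.+1`!)%:R^-1 - (M.+2`!)%:R^-1 :> R.
    rewrite [M.+2`!]factS natrM -[M.+2%:R]natr1.
    by field; rewrite (gt_eqF M1) gt_eqF// ltr_pwDr// addr_ge0.
  rewrite mulrC -mulrA ler_piMl ?exprn_ile1// mulr_ge0 ?exprn_ge0//.
  by rewrite subr_ge0 lef_pV2 ?posrE ?ltr0n ?fact_gt0// ler_nat factS leq_pmull.
apply: (@le_trans _ _ (\sum_(l < N.+2) `|(1 - l%:R) / (l`!)%:R| * r ^+ l)).
  by rewrite !big_ord_recr /= -addrA lerDl addr_ge0// mulr_ge0// exprn_ge0.
by apply: le_trans (key N) _; rewrite lerD2l ler_piMr ?exprn_ge0// gerBl invr_ge0.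
Qed.

(** The weighted sum of absolute coefficients is submultiplicative under Cauchy products, so the
    bound for one factor is raised to the power [n]. *)
Lemma sum_norm_tcoef_le (R : realType) (r : R) (n N : nat) : 0 <= r <= 1 ->
  \sum_(m < N) `|tcoef R n m| * r ^+ m <= (1 + r ^+ 2) ^+ n.
Proof.
move=> r01; have /andP[r0 r1] := r01; elim: n N => [|n IH] N.
  case: N => [|N]; first by rewrite big_ord0 expr0.
  rewrite big_ord_recl big1 => [|i _]; rewrite tcoef0 ?normr0 ?mul0r//.
  by rewrite normr1 expr0 mulr1 addr0.
apply: (@le_trans _ _ (\sum_(m < N) \sum_(i < m.+1)
    (`|tcoef R n i| * r ^+ i) *
    (`|(1 - (m - i)%:R) / ((m - i)`!)%:R| * r ^+ (m - i)))).
  apply: ler_sum => m _; rewrite tcoefS.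
  apply: (@le_trans _ _ ((\sum_(i < m.+1)
     `|tcoef R n i * ((1 - (m - i)%:R) / ((m - i)`!)%:R)|) * r ^+ m)).
    by rewrite ler_wpM2r ?exprn_ge0// ler_norm_sum.
  rewrite mulr_suml; apply: ler_sum => i _; rewrite normrM mulrACA -exprD.
  by rewrite subnKC// -ltnS.
rewrite (sum_conv _ (fun i l =>
  `|tcoef R n i| * r ^+ i * (`|(1 - l%:R) / (l`!)%:R| * r ^+ l))).
apply: (@le_trans _ _ (\sum_(i < N) `|tcoef R n i| * r ^+ i * (1 + r ^+ 2))).
  apply: ler_sum => i _; rewrite -mulr_sumr ler_wpM2l ?sum_coef1_le//.
  by rewrite mulr_ge0// exprn_ge0.
by rewrite -mulr_suml (exprSr (1 + r ^+ 2)) ler_wpM2r// addr_ge0// exprn_ge0.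
Qed.

(** * Taylor remainders on the unit interval *)

Lemma norm_expR_1B_le1 (R : realType) (x : R) : 0 <= x <= 1 ->
  `|expR x * (1 - x)| <= 1.
Proof.
move=> /andP[x0 x1]; rewrite ger0_norm; last by rewrite mulr_ge0 ?expR_ge0 ?subr_ge0.
by rewrite -ler_pdivlMl ?expR_gt0// mulr1 -expRN expR_ge1Dx.
Qed.

(** With [T N] the tail of the exponential series, the remainder at order [l + 1] is
    [T (l+1) - x T l]. Both quantities lie between 0 and [e x^(l+1)], hence so does the absolute
    value of their difference. *)
Lemma expR_1B_remainder (R : realType) (x : R) (l : nat) : 0 <= x <= 1 ->
  `|expR x * (1 - x) - \sum_(j < l) (1 - j%:R) / (j`!)%:R * x ^+ j|
  <= expR 1 * x ^+ l.
Proof.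
move=> x01; have /andP[x0 x1] := x01; case: l => [|l].
  rewrite big_ord0 subr0 expr0 mulr1 (le_trans (norm_expR_1B_le1 _ _ x01))//.
  by rewrite -expR0 ler_expR.
pose T N := expR x - \sum_(0 <= j < N) x ^+ j / (j`!)%:R.
have T_ge0 N : 0 <= T N by rewrite subr_ge0 expR_series_ge.
have T_le N : T N <= x ^+ N * expR 1.
  by rewrite (le_trans (expR_series_tail _ _ _ x0))// ler_wpM2l ?exprn_ge0// ler_expR.
have -> : expR x * (1 - x) - \sum_(j < l.+1) (1 - j%:R) / (j`!)%:R * x ^+ j =
    T l.+1 - x * T l.
  rewrite /T !big_mkord.
  have -> : \sum_(j < l.+1) (1 - j%:R) / (j`!)%:R * x ^+ j =
      \sum_(j < l.+1) x ^+ j / (j`!)%:R - x * \sum_(j < l) x ^+ j / (j`!)%:R.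
    rewrite -[X in _ = _ - X]add0r.
    have -> : 0 + x * \sum_(j < l) x ^+ j / (j`!)%:R =
        \sum_(j < l.+1) j%:R / (j`!)%:R * x ^+ j.
      rewrite big_ord_recl !mul0r; congr (_ + _); rewrite mulr_sumr.
      apply: eq_bigr => j _; rewrite !lift0 factS natrM exprS.
      by field; rewrite nat1r !pnatr_eq0 -lt0n fact_gt0.
    by rewrite -sumrB; apply: eq_bigr => j _; ring.
  by ring.
have xT : 0 <= x * T l <= expR 1 * x ^+ l.+1.
  by rewrite mulr_ge0//= exprS mulrCA ler_wpM2l// mulrC.
have := T_le l.+1; have := T_ge0 l.+1; move: xT => /andP[? ?] ? ?.
by rewrite ler_norml; apply/andP; split; lra.
Qed.

(** Induction on [n]. Multiplying the old remainder by [f] costs nothing since [|f| <= 1] on the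
    unit interval; the truncation of the new factor adds at most [e (1 + r^2)^n (x/r)^M]. Hence the
    prefactor [1 + e n] is linear in [n]. *)
Lemma expR_1B_exp_remainder (R : realType) (n M : nat) (x r : R) :
  0 <= x <= 1 -> 0 < r <= 1 ->
  `|(expR x * (1 - x)) ^+ n - \sum_(m < M) tcoef R n m * x ^+ m|
  <= (1 + expR 1 * n%:R) * (1 + r ^+ 2) ^+ n * (x / r) ^+ M.
Proof.
move=> x01 /andP[r0 r1]; have /andP[x0 x1] := x01.
have xr0 : 0 <= x / r by rewrite divr_ge0// ltW.
elim: n => [|n IH].
  rewrite mulr0 addr0 !expr0 !mul1r; case: M => [|M].
    by rewrite big_ord0 subr0 normr1 expr0.
  rewrite big_ord_recl big1 => [|i _]; rewrite tcoef0 ?mul0r//.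
  by rewrite expr0 mulr1 addr0 subrr normr0 exprn_ge0.
have -> : \sum_(m < M) tcoef R n.+1 m * x ^+ m =
    \sum_(i < M) \sum_(l < M - i) (tcoef R n i * x ^+ i) *
       ((1 - l%:R) / (l`!)%:R * x ^+ l).
  rewrite -(sum_conv _ (fun i l => (tcoef R n i * x ^+ i) *
       ((1 - l%:R) / (l`!)%:R * x ^+ l))).
  apply: eq_bigr => m _; rewrite tcoefS mulr_suml; apply: eq_bigr => i _.
  by rewrite [RHS]mulrACA -exprD subnKC// -ltnS.
set f := expR x * (1 - x).
under eq_bigr => i _ do rewrite -mulr_sumr.
rewrite (_ : _ - _ = (f ^+ n - \sum_(m < M) tcoef R n m * x ^+ m) * f +
   \sum_(i < M) tcoef R n i * x ^+ i *
     (f - \sum_(l < M - i) (1 - l%:R) / (l`!)%:R * x ^+ l)); last first.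
  under [X in _ = _ + X]eq_bigr => i _ do rewrite mulrBr.
  by rewrite sumrB mulrBl mulr_suml (exprSr f) addrA subrK.
apply: (le_trans (ler_normD _ _)).
apply: (@le_trans _ _ ((1 + expR 1 * n%:R) * (1 + r ^+ 2) ^+ n * (x / r) ^+ M +
   \sum_(i < M) `|tcoef R n i| * r ^+ i * (expR 1 * (x / r) ^+ M))).
  apply: lerD.
    by rewrite normrM -[leRHS]mulr1 ler_pM// norm_expR_1B_le1.
  apply: (le_trans (ler_norm_sum _ _ _)); apply: ler_sum => i _.
  rewrite normrM [`|tcoef _ _ _ * _|]normrM -!mulrA ler_wpM2l// normrX (ger0_norm x0).
  apply: (@le_trans _ _ (x ^+ i * (expR 1 * x ^+ (M - i)))).
    by rewrite ler_wpM2l ?exprn_ge0// expR_1B_remainder.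
  have iM : (i <= M)%N := ltnW (ltn_ord i).
  rewrite mulrCA -exprD subnKC// [leRHS]mulrCA ler_wpM2l ?expR_ge0//.
  rewrite expr_div_n mulrCA ler_peMr ?exprn_ge0// ler_pdivlMr ?exprn_gt0// mul1r.
  by rewrite ler_wiXn2l// ltW.
rewrite -mulr_suml -natr1.
apply: (@le_trans _ _ ((1 + expR 1 * n%:R) * (1 + r ^+ 2) ^+ n * (x / r) ^+ M +
  (1 + r ^+ 2) ^+ n * (expR 1 * (x / r) ^+ M))).
  rewrite lerD2l ler_wpM2r ?mulr_ge0 ?expR_ge0 ?exprn_ge0//.
  by rewrite sum_norm_tcoef_le// ltW//= r1.
rewrite [leLHS](_ : _ = (1 + expR 1 * (n%:R + 1)) * (1 + r ^+ 2) ^+ n * (x / r) ^+ M); last by ring.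
rewrite ler_wpM2r ?exprn_ge0// ler_wpM2l ?addr_ge0 ?mulr_ge0 ?expR_ge0//.
by rewrite (exprS (1 + r ^+ 2)) ler_peMl ?exprn_ge0 ?addr_ge0 ?lerDl ?exprn_ge0// ltW.
Qed.

(** * The truncated expansion *)

(** The intermediate value theorem on [[0, x]] provides a root, since [x <= x e^x]; so [xget] does
    not return its default, and the sign of [w e^w] is that of [w]. *)
Lemma lambertW_spec (R : realType) (x : R) : 0 < x ->
  0 < lambertW x /\ lambertW x * expR (lambertW x) = x.
Proof.
move=> x0; have [w w0 wx] : exists2 w : R, 0 <= w & w * expR w = x.
  have [||w] := @IVT R (fun w => w * expR w) 0 x x (ltW x0).
  - apply: continuous_subspaceT => w; apply: continuousM => //.
    exact: continuous_expR.
  - rewrite mul0r ge_min le_max (ltW x0) /=.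
    by rewrite ler_peMr ?(ltW x0) ?orbT// -expR0 ler_expR ltW.
  - by rewrite in_itv/= => /andP[w0 _] wx; exists w.
have [_ lW] : [set w : R | -1 <= w /\ w * expR w = x]%classic (lambertW x).
  by apply: (@xgetI _ _ _ w); split=> //; rewrite (le_trans _ w0)// lerN10.
by split=> //; rewrite -(pmulr_lgt0 _ (expR_gt0 (lambertW x))) lW.
Qed.

(** At [a = n] this is [lambda] as a function of a real [k], needed because the upper end of the
    range is not an integer in general. *)
Lemma mul_expR_div_mono (R : realType) (a : R) : 0 < a ->
  {in Num.pos &, {mono (fun t : R => t * expR (- (a / t))) : x y / x <= y}}.
Proof.
move=> a0; apply: le_mono_in => x y; rewrite !posrE => x0 y0 xy.
rewrite ltr_pM ?expR_ge0 ?(ltW x0)// ltr_expR ltrN2 ltr_pM2l//.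
by rewrite ltf_pV2 ?posrE.
Qed.

Lemma lambda_ge1E (R : realType) (n k : nat) : (0 < k)%N ->
  (1 <= lambda R n k) = (n%:R / k%:R <= ln (k%:R : R)).
Proof.
move=> k0; have kR : (0 : R) < k%:R by rewrite ltr0n.
rewrite /lambda -[X in X * _](lnK (kR : k%:R \is Num.pos)) -expRD -expR0.
by rewrite ler_expR subr_ge0.
Qed.

(** Lower ends: [n / W = e^W], and [lambda >= 1] means [W e^W = n <= k ln k], compared through the
    growth of [y e^y]. Upper ends: [lambda] at the real point [u = 2n / (ln n + 6)] is exactly the
    stated bound, as [n / u = (ln n) / 2 + 3]. *)
Lemma range_lambdaE (R : realType) (n k : nat) : (0 < n)%N -> (0 < k)%N ->
  (n%:R / lambertW (n%:R : R) <= k%:R <= 2 * n%:R / (ln (n%:R : R) + 6)) =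
  (1 <= lambda R n k
     <= 2 / expR 3 * (Num.sqrt (n%:R : R) / (ln (n%:R : R) + 6))).
Proof.
move=> n0 k0; have nR : (0 : R) < n%:R by rewrite ltr0n.
have kR : (0 : R) < k%:R by rewrite ltr0n.
have [W0 WE] := lambertW_spec _ _ nR; set W := lambertW _ in W0 WE *.
have L6 : 0 < ln (n%:R : R) + 6 by rewrite ltr_wpDl// ln_ge0// ler1n.
congr (_ && _).
  have -> : n%:R / W = expR W by rewrite -{1}WE mulrC mulKf ?gt_eqF.
  rewrite lambda_ge1E// -[X in expR W <= X](lnK (kR : k%:R \is Num.pos)) ler_expR.
  rewrite ler_pdivrMr// -[in RHS]WE -[in X in _ <= _ * X](lnK (kR : k%:R \is Num.pos)).
  apply/idP/idP => [Wk|]; first by rewrite ler_pM ?expR_ge0 ?ler_expR ?(ltW W0).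
  apply: contraTT; rewrite -!ltNge => kW.
  have [l0|l0] := ltP 0 (ln (k%:R : R)).
    by rewrite ltr_pM ?expR_ge0 ?ltr_expR// ltW.
  apply: (@le_lt_trans _ _ 0); last by rewrite mulr_gt0 ?expR_gt0.
  by rewrite mulr_le0_ge0 ?expR_ge0.
pose u : R := 2 * n%:R / (ln (n%:R : R) + 6).
have u0 : 0 < u by rewrite divr_gt0// mulr_gt0.
rewrite -/u -[LHS](mul_expR_div_mono _ _ nR) ?posrE// /lambda /=.
congr (_ <= _)%R.
have -> : n%:R / u = 2^-1 * ln (n%:R : R) + 3.
  by rewrite /u; field; rewrite !gt_eqF.
rewrite opprD expRD !expRN.
have -> : expR (2^-1 * ln (n%:R : R)) = Num.sqrt n%:R.
  by rewrite -powR12_sqrt ?ltW// /powR gt_eqF.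
have s0 : 0 < Num.sqrt (n%:R : R) by rewrite sqrtr_gt0.
rewrite /u -{1}(sqr_sqrtr (ltW nR)).
by field; rewrite !gt_eqF// expR_gt0.
Qed.

(** Since [q^j = e^(-n j / k)], the inclusion-exclusion term is [C(k,j) (-q)^j f(j)^n]. The Taylor
    polynomial of [f^n] sums to the [Qbar] terms, and the remainder is bounded term by term, losing
    the signs. *)
Lemma Snk_expansion (R : realType) (n k M : nat) (r : R) :
  (0 < k)%N -> (k <= n)%N -> lambda R n k < k%:R -> 0 < r <= 1 ->
  `|Snk R n k - (1 - lambda R n k / k%:R) ^+ k *
      \sum_(m < M) tcoef R n m / k%:R ^+ m * Qbar R n k m|
  <= (1 + expR 1 * n%:R) * (1 + r ^+ 2) ^+ n *
     ((M`!)%:R / (r * k%:R) ^+ M) *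
     (1 + lambda R n k / k%:R * expR 1) ^+ k.
Proof.
move=> k0 kn lk r01; have kR : (0 : R) < k%:R by rewrite ltr0n.
have /andP[r0 r1] := r01.
set q := lambda R n k / k%:R.
have q0 : 0 <= q by rewrite divr_ge0// mulr_ge0// expR_ge0.
have qE : q = expR (- (n%:R / k%:R)) by rewrite /q /lambda mulrAC mulfV ?mul1r ?gt_eqF.
pose f (j : nat) : R := expR (j%:R / k%:R) * (1 - j%:R / k%:R).
pose rem (j : nat) := f j ^+ n - \sum_(m < M) tcoef R n m * (j%:R / k%:R) ^+ m.
have -> : Snk R n k - (1 - q) ^+ k *
      \sum_(m < M) tcoef R n m / k%:R ^+ m * Qbar R n k m =
    \sum_(j < k.+1) 'C(k, j)%:R * (- q) ^+ j * rem j.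
  rewrite Snk_sum// mulr_sumr.
  under [X in _ - X]eq_bigr => m _ do rewrite mulrCA -Qbar_sum// mulr_sumr.
  rewrite [X in _ - X]exchange_big -sumrB /=; apply: eq_bigr => j _.
  rewrite /rem mulrBr; congr (_ - _); last first.
    by rewrite mulr_sumr; apply: eq_bigr => m _; rewrite expr_div_n; ring.
  rewrite /f exprMn -expRM_natl (exprNn q) qE -expRM_natl -!mulrA.
  congr (_ * (_ * _)); rewrite mulrA -expRD.
  rewrite (_ : j%:R * _ + _ = 0) ?expR0 ?mul1r//; ring.
apply: (le_trans (ler_norm_sum _ _ _)).
apply: (@le_trans _ _ (\sum_(j < k.+1) 'C(k, j)%:R * q ^+ j *
  ((1 + expR 1 * n%:R) * (1 + r ^+ 2) ^+ n * (j%:R / k%:R / r) ^+ M))).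
  apply: ler_sum => j _; rewrite normrM normrM normrX normrN (ger0_norm q0) normr_nat.
  rewrite ler_wpM2l ?mulr_ge0 ?exprn_ge0//.
  apply: expR_1B_exp_remainder => //; rewrite divr_ge0//= ler_pdivrMr// mul1r.
  by rewrite ler_nat -ltnS.
set c := (1 + _) * _.
have -> : \sum_(j < k.+1) 'C(k, j)%:R * q ^+ j * (c * (j%:R / k%:R / r) ^+ M) =
    c / (r * k%:R) ^+ M * \sum_(j < k.+1) 'C(k, j)%:R * q ^+ j * j%:R ^+ M.
  rewrite mulr_sumr; apply: eq_bigr => j _.
  rewrite (_ : j%:R / k%:R / r = j%:R / (r * k%:R)); last first.
    by rewrite -mulrA -invfM (mulrC k%:R).
  by rewrite [(_ / _) ^+ M]expr_div_n; ring.
have c0 : 0 <= c.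
  by rewrite mulr_ge0 ?exprn_ge0 ?addr_ge0 ?mulr_ge0 ?expR_ge0 ?exprn_ge0// ltW.
(* The factor [1 ^+ M] exposes the choice [rho = 1] in [sum_bin_natX_le]. *)
rewrite [leRHS](_ : _ = c / (r * k%:R) ^+ M *
  ((M`!)%:R / 1 ^+ M * (1 + q * expR 1) ^+ k)); last by rewrite expr1n divr1; ring.
rewrite ler_wpM2l ?sum_bin_natX_le//.
by rewrite divr_ge0// exprn_ge0// mulr_ge0 ?ltW.
Qed.

Lemma tcoefn0 (R : realType) (n : nat) : tcoef R n 0 = 1.
Proof.
elim: n => [|n IH]; first by rewrite tcoef0.
by rewrite tcoefS big_ord1 IH subr0 mul1r divr1.
Qed.

(** This is why the sum in the expansion starts at [m = 2]. *)
Lemma tcoefn1 (R : realType) (n : nat) : tcoef R n 1 = 0.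
Proof.
elim: n => [|n IH]; first by rewrite tcoef0.
by rewrite tcoefS big_ord_recl big_ord1 /= IH subrr !(mul0r, mulr0) addr0.
Qed.

Lemma Qbar0 (R : realType) (n k : nat) : Qbar R n k 0 = 1.
Proof.
have := expn_stirling2 0 0; rewrite big_ord1 muln1 expn0 => s00.
by rewrite /Qbar big_nat1 bin0 -s00 fact0 expr0 !mulr1.
Qed.

(** * Size of the terms and of the remainder *)

Lemma range_facts (R : realType) (n k : nat)
  (L := ln (n%:R : R)) (s := Num.sqrt (n%:R : R)) (l := lambda R n k) :
  (0 < n)%N -> (0 < k)%N -> k%:R <= 2 * n%:R / (L + 6) ->
  1 <= l <= 2 / expR 3 * (s / (L + 6)) ->
  [/\ 0 < L, (k <= n)%N, n%:R <= k%:R * L & l / k%:R <= 4^-1]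
  /\ l <= s /\ l * L / s <= 1.
Proof.
move=> n0 k0 kle /andP[l1 lle].
have nR : (0 : R) < n%:R by rewrite ltr0n.
have kR : (0 : R) < k%:R by rewrite ltr0n.
have s0 : 0 < s by rewrite sqrtr_gt0.
have L0 : 0 <= L by rewrite ln_ge0// ler1n.
have L6 : 0 < L + 6 by lra.
have e3 : 4 <= expR 3 :> R by rewrite (le_trans _ (expR_ge1Dx _))//; lra.
have e3_gt0 : 0 < expR 3 :> R by rewrite expR_gt0.
have e3h : 2 / expR 3 <= 2^-1 :> R by rewrite ler_pdivrMr//; lra.
have sL : 0 <= s / (L + 6) by rewrite divr_ge0// ltW.
have lle' : l <= 2^-1 * (s / (L + 6)) by rewrite (le_trans lle)// ler_wpM2r.
(* [n = 1] is impossible: it would force [lambda <= 1/12], against [lambda >= 1]. *)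
have {}L0 : 0 < L.
  rewrite lt_neqAle L0 andbT; apply/eqP => L_0.
  have : (n%:R : R) == 1 by rewrite -ln_eq0// -/L -L_0.
  move=> /eqP n1; move: lle'; rewrite -L_0 /s n1 sqrtr1 add0r; lra.
have kn : (k <= n)%N.
  rewrite -(ler_nat R) (le_trans kle)// ler_pdivrMr// mulrC ler_wpM2l ?ltW//; lra.
(* [lambda >= 1] says [n / k <= ln k], and [ln k <= ln n]. *)
have nk : n%:R <= k%:R * L.
  move: (l1); rewrite /l lambda_ge1E// ler_pdivrMr// mulrC => /le_trans; apply.
  by rewrite ler_wpM2l ?(ltW kR)// ler_ln ?posrE// ler_nat.
split; [split=> //|split].
- rewrite /l /lambda mulrAC mulfV ?gt_eqF// mul1r expRN lef_pV2 ?posrE ?expR_gt0//.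
  rewrite (le_trans e3)// ler_expR ler_pdivlMr//.
  by move: kle; rewrite ler_pdivlMr// => kle; nra.
- by rewrite (le_trans lle')// mulrCA ler_piMr ?(ltW s0)// ler_pdivrMr//; lra.
- rewrite ler_pdivrMr// mul1r -ler_pdivlMr// (le_trans lle')//.
  rewrite mulrCA ler_wpM2l ?(ltW s0)// -invfM lef_pV2 ?posrE ?mulr_gt0//; lra.
Qed.

(** The signs are dropped and the Stirling sum is bounded at [t = Lambda], where
    [k Lambda <= 2 lambda]. With [2 lambda rho <= m], the exponential factor is only [e^(e m)]. *)
Lemma norm_Qbar_le (R : realType) (n k m : nat) : (0 < k)%N -> (0 < m)%N ->
  lambda R n k / k%:R <= 4^-1 ->
  `|Qbar R n k m| <= (expR (expR 1) * (m%:R + 2 * lambda R n k)) ^+ m.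
Proof.
move=> k0 m0; set l := lambda R n k => q4.
have kR : (0 : R) < k%:R by rewrite ltr0n.
have mR : (0 : R) < m%:R by rewrite ltr0n.
have l0 : 0 < l by rewrite /l /lambda mulr_gt0// expR_gt0.
have lk : l <= 4^-1 * k%:R by rewrite -ler_pdivrMr.
have kl : 0 < k%:R - l by lra.
have t01 : 0 <= Lambda R n k < 1.
  by rewrite /Lambda -/l divr_ge0 ?(ltW l0) ?(ltW kl)//= ltr_pdivrMr//; lra.
have [t0 t1] := andP t01.
have kt : k%:R * Lambda R n k <= 2 * l.
  by rewrite /Lambda -/l mulrCA [leRHS]mulrC ler_wpM2l ?(ltW l0)// ler_pdivrMr//; lra.
(* About min(1, m / lambda): large enough, yet the exponent stays O(m). *)
pose rho := m%:R / (m%:R + 2 * l).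
have ml : 0 < m%:R + 2 * l by lra.
have rho0 : 0 < rho by rewrite divr_gt0.
have rho1 : rho <= 1 by rewrite ler_pdivrMr//; lra.
apply: (@le_trans _ _ (\sum_(0 <= i < m.+1)
    'C(k, i)%:R * (stirling2 m i)%:R * (i`!)%:R * Lambda R n k ^+ i)).
  apply: (le_trans (ler_norm_sum _ _ _)); apply: ler_sum => i _.
  by rewrite !normrM normrX normrN (ger0_norm t0) !normr_nat.
apply: (le_trans (sum_bin_stirling2_le _ k m _ _ t01 rho0)).
have em : k%:R * (Lambda R n k * (expR rho - 1)) <= m%:R * expR 1.
  have e_rho : expR rho - 1 <= rho * expR 1.
    have := expR_series_tail _ _ 1 (ltW rho0).
    rewrite big_nat1 expr0 fact0 divr1 expr1 => /le_trans; apply.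
    by rewrite ler_wpM2l ?(ltW rho0)// ler_expR.
  rewrite mulrA; apply: (@le_trans _ _ (2 * l * (rho * expR 1))).
    apply: ler_pM => //; first by rewrite mulr_ge0.
    by rewrite subr_ge0 ltW// pexpR_gt1.
  rewrite mulrA ler_wpM2r ?expR_ge0// /rho mulrCA ler_piMr ?(ltW mR)//.
  by rewrite ler_pdivrMr//; lra.
apply: (@le_trans _ _ ((m%:R / rho) ^+ m * expR (m%:R * expR 1))).
  rewrite [(_ / rho) ^+ m]expr_div_n; apply: ler_pM; rewrite ?expR_ge0 ?ler_expR//.
    by rewrite divr_ge0 ?exprn_ge0 ?(ltW rho0).
  rewrite ler_wpM2r ?invr_ge0 ?exprn_ge0 ?(ltW rho0)//.
  by rewrite -natrX ler_nat fact_le_expn.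
rewrite expRM_natl -exprMn mulrC (_ : m%:R / rho = m%:R + 2 * l)//.
by rewrite /rho; field; rewrite !gt_eqF.
Qed.

(** A Cauchy-type estimate: a single term of the weighted sum is at most
    [(1 + r^2)^n <= e^(n r^2) = e^m]; [m <= n] keeps the radius at most 1. *)
Lemma norm_tcoef_le (R : realType) (n m : nat) : (0 < m <= n)%N ->
  `|tcoef R n m| <=
  (expR 1 * (Num.sqrt n%:R / Num.sqrt m%:R)) ^+ m.
Proof.
move=> /andP[m0 mn].
have mR : (0 : R) < m%:R by rewrite ltr0n.
have nR : (0 : R) < n%:R by rewrite ltr0n (leq_trans m0).
have sm0 : 0 < Num.sqrt (m%:R : R) by rewrite sqrtr_gt0.
have sn0 : 0 < Num.sqrt (n%:R : R) by rewrite sqrtr_gt0.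
(* Minimizes e^(n r^2) / r^m up to a constant to the power m. *)
pose r : R := Num.sqrt m%:R / Num.sqrt n%:R.
have r0 : 0 < r by rewrite divr_gt0.
have r1 : r <= 1 by rewrite ler_pdivrMr// mul1r ler_sqrt ?ler_nat// ltW.
have r01 : 0 <= r <= 1 by rewrite ltW.
have := sum_norm_tcoef_le _ r n m.+1 r01; rewrite big_ord_recr /= => h.
have {}h : `|tcoef R n m| * r ^+ m <= (1 + r ^+ 2) ^+ n.
  apply: le_trans h; rewrite lerDr sumr_ge0// => i _.
  by rewrite mulr_ge0// exprn_ge0// ltW.
have {h} : `|tcoef R n m| * r ^+ m <= expR 1 ^+ m.
  apply: (le_trans h); apply: le_trans.
    by apply: exprn_1D_le_expR; rewrite addr_ge0// exprn_ge0// ltW.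
  rewrite -expRM_natl mulr1 ler_expR /r expr_div_n !sqr_sqrtr ?(ltW mR) ?(ltW nR)//.
  by rewrite mulrCA mulfV ?mulr1 ?gt_eqF.
rewrite -ler_pdivlMr ?exprn_gt0// => /le_trans; apply.
by rewrite -expr_div_n /r invf_div.
Qed.

Lemma norm_term_le (R : realType) (n k m : nat)
  (L := ln (n%:R : R)) (s := Num.sqrt (n%:R : R)) (l := lambda R n k) :
  (0 < k)%N -> (0 < m <= n)%N -> n%:R <= k%:R * L -> l / k%:R <= 4^-1 ->
  `|tcoef R n m / k%:R ^+ m * Qbar R n k m| <=
  (expR 1 * expR (expR 1) *
    (Num.sqrt m%:R * (L / s) + 2 * (l * L / s) / Num.sqrt m%:R)) ^+ m.
Proof.
move=> k0 /[dup] mn01 /andP[m0 mn] nk q4.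
have mR : (0 : R) < m%:R by rewrite ltr0n.
have nR : (0 : R) < n%:R by rewrite ltr0n (leq_trans m0).
have kR : (0 : R) < k%:R by rewrite ltr0n.
have sm0 : 0 < Num.sqrt (m%:R : R) by rewrite sqrtr_gt0.
have s0 : 0 < s by rewrite sqrtr_gt0.
have l0 : 0 < l by rewrite /l /lambda mulr_gt0// expR_gt0.
rewrite 2!normrM normfV normrX (ger0_norm (ltW kR)).
apply: (@le_trans _ _ ((expR 1 * (s / Num.sqrt m%:R)) ^+ m / k%:R ^+ m *
   (expR (expR 1) * (m%:R + 2 * l)) ^+ m)).
  rewrite ler_pM ?divr_ge0 ?exprn_ge0 ?(ltW kR) ?norm_Qbar_le//.
  by rewrite ler_wpM2r ?invr_ge0 ?exprn_ge0 ?(ltW kR)// norm_tcoef_le.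
rewrite -expr_div_n -exprMn lerXn2r ?nnegrE//.
- by rewrite !(mulr_ge0, invr_ge0, expR_ge0, addr_ge0, sqrtr_ge0, ler0n, ltW l0).
- have L0 : 0 <= L by rewrite -(pmulr_rge0 _ kR) (le_trans _ nk)// ltW.
  by rewrite !(mulr_ge0, invr_ge0, expR_ge0, addr_ge0, sqrtr_ge0, ler0n, ltW l0, L0).
have kV : k%:R^-1 <= L / s ^+ 2.
  by rewrite (sqr_sqrtr (ltW nR)) ler_pdivlMr// mulrC ler_pdivrMr// mulrC.
set c := expR 1 * expR (expR 1).
rewrite [leLHS](_ : _ = c * (s / Num.sqrt m%:R) * (m%:R + 2 * l) * k%:R^-1); last first.
  by rewrite /c; ring.
apply: (@le_trans _ _ (c * (s / Num.sqrt m%:R) * (m%:R + 2 * l) * (L / s ^+ 2))).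
  by rewrite ler_wpM2l// !(mulr_ge0, invr_ge0, expR_ge0, addr_ge0, sqrtr_ge0, ler0n, ltW l0).
rewrite -[X in X + 2 * l](sqr_sqrtr (ltW mR)) le_eqVlt; apply/orP; left; apply/eqP.
by field; rewrite !gt_eqF.
Qed.

(** Applied with [a = L / s] and [x = lambda L / s]. For [m >= m0] the base is at most [1/(2e)]:
    [2 s1] factors are spent on [x^(2 s1)], and the rest gives [2^(-m)] with [e^(-m)] to spare. The
    finitely many smaller [m] use [x^m <= x^(2 s1)]. *)
Lemma geometric_term (R : realType) (A : R) (s1 : nat) : 1 <= A ->
  exists d K : R, [/\ 0 < d, 0 <= K &
    forall (m : nat) (a x : R), (0 < m)%N -> (2 * s1 <= m)%N ->
      0 <= a <= x -> x <= 1 -> Num.sqrt m%:R * a <= d ->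
      (A * (Num.sqrt m%:R * a + 2 * x / Num.sqrt m%:R)) ^+ m
      <= K * x ^+ (2 * s1) * 2^-1 ^+ m].
Proof.
move=> A1; have A0 : 0 < A by lra.
set e : R := expR 1; have e0 : 0 < e by rewrite expR_gt0.
have Ae : 0 < A * e by rewrite mulr_gt0.
(* From [m0] on, [sqrt m >= 8 A e], so the second summand of the base is at most [1/(4e)]; the value
   of [d] does the same for the first. *)
pose m0 := (Num.truncn ((8 * A * e) ^+ 2)).+1.
pose K1 : R := (3 * A * (2 * e)) ^+ (2 * s1) * (s1`!)%:R.
pose K2 : R := 2 ^+ m0 * (3 * A * m0%:R) ^+ m0.
have K1_ge0 : 0 <= K1 by rewrite !(mulr_ge0, exprn_ge0, ler0n, ltW A0, ltW e0).
have K2_ge0 : 0 <= K2 by rewrite !(mulr_ge0, exprn_ge0, ler0n, ltW A0).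
exists (4 * (A * e))^-1, (K1 + K2); split; [by rewrite invr_gt0 mulr_gt0|exact: addr_ge0|].
move=> m a x m_gt0 sm /andP[a0 ax] x1 ma.
have x0 : 0 <= x := le_trans a0 ax.
have mR : (1 : R) <= m%:R by rewrite ler1n.
set sm' := Num.sqrt (m%:R : R); have sm1 : 1 <= sm' by rewrite -sqrtr1 ler_sqrt.
have sm0 : 0 < sm' by lra.
have smE : sm' ^+ 2 = m%:R by rewrite sqr_sqrtr.
set b := A * _.
have b0 : 0 <= b.
  by rewrite /b !(mulr_ge0, addr_ge0, invr_ge0, ltW A0, ltW sm0, x0, a0).
have b3 : b <= 3 * A * sm' * x.
  rewrite /b [3 * A]mulrC -!mulrA ler_wpM2l ?(ltW A0)//.
  have : sm' * a <= sm' * x by rewrite ler_wpM2l ?(ltW sm0).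
  have : x / sm' <= sm' * x.
    rewrite ler_pdivrMr// -mulrA mulrCA -{1}[x]mulr1 ler_wpM2l//; nra.
  lra.
have [m0m|mm0] := leqP m0 m.
  have sm8 : 8 * A * e <= sm'.
    have Ae8 : 0 <= 8 * A * e by rewrite -mulrA mulr_ge0// ltW.
    rewrite -(@ler_pXn2r _ 2) ?nnegrE ?(ltW sm0)// smE.
    by rewrite ltW// (lt_le_trans (truncnS_gt _))// ler_nat.
  have be : b <= (2 * e)^-1.
    have b1 : A * (sm' * a) <= (4 * e)^-1.
      rewrite -ler_pdivlMl//; apply: le_trans ma _.
      by rewrite !invfM mulrC le_eqVlt; apply/orP; left; apply/eqP; ring.
    have b2 : A * (2 * x / sm') <= (4 * e)^-1.
      rewrite mulrA ler_pdivrMr// ler_pdivlMl ?mulr_gt0//.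
      apply: le_trans sm8; rewrite [leLHS](_ : _ = 8 * A * e * x); last by ring.
      by rewrite ler_piMr// -mulrA mulr_ge0// ltW.
    rewrite /b mulrDr (_ : (2 * e)^-1 = (4 * e)^-1 + (4 * e)^-1); first exact: lerD.
    by field; rewrite gt_eqF.
  rewrite -{1}(subnKC sm) exprD.
  apply: (@le_trans _ _ ((3 * A * sm' * x) ^+ (2 * s1) * (2 * e)^-1 ^+ (m - 2 * s1))).
    by rewrite ler_pM ?exprn_ge0 ?lerXn2r ?nnegrE ?(le_trans b0).
  (* The extracted factors contribute [m^s1], absorbed by the spare [e^(-m)]. *)
  have ms : sm' ^+ (2 * s1) <= (s1`!)%:R * e ^+ m.
    by rewrite exprM smE -expRM_natl mulr1 exprn_le_fact_expR.
  have eE : (2 * e)^-1 ^+ (m - 2 * s1) = (2 * e) ^+ (2 * s1) * 2^-1 ^+ m / e ^+ m.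
    rewrite -[in RHS](subnKC sm) !exprD !exprVn !exprMn.
    by field; rewrite ?expf_neq0 ?gt_eqF.
  rewrite eE !exprMn.
  apply: (@le_trans _ _ ((3 ^+ (2 * s1) * A ^+ (2 * s1) *
      ((s1`!)%:R * e ^+ m) * x ^+ (2 * s1)) *
    (2 ^+ (2 * s1) * e ^+ (2 * s1) * 2^-1 ^+ m / e ^+ m))).
    rewrite ler_wpM2r//.
      by rewrite !(mulr_ge0, exprn_ge0, invr_ge0, ler0n, ltW e0).
    rewrite ler_wpM2r ?exprn_ge0// ler_wpM2l//.
    by rewrite !(mulr_ge0, exprn_ge0, ler0n, ltW A0).
  rewrite [leLHS](_ : _ = K1 * x ^+ (2 * s1) * 2^-1 ^+ m); last first.
    by rewrite /K1 !exprMn; field; rewrite expf_neq0// gt_eqF.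
  rewrite ler_wpM2r ?exprn_ge0 ?invr_ge0// ler_wpM2r ?exprn_ge0//.
  by rewrite lerDl.
have m0R : (m%:R : R) <= m0%:R by rewrite ler_nat ltnW.
have c1 : 1 <= 3 * A * m0%:R by nra.
apply: (@le_trans _ _ ((3 * A * m0%:R * x) ^+ m)).
  have c0 : 0 <= 3 * A * m0%:R * x by rewrite mulr_ge0// (le_trans _ c1).
  rewrite lerXn2r ?nnegrE// (le_trans b3)// ler_wpM2r//.
  rewrite ler_wpM2l ?mulr_ge0 ?(ltW A0)// (le_trans _ m0R)// -smE.
  by rewrite expr2 ler_peMl// ltW.
rewrite exprMn.
apply: (@le_trans _ _ ((3 * A * m0%:R) ^+ m0 * x ^+ (2 * s1))).
  rewrite ler_pM ?exprn_ge0 ?(le_trans _ c1)//.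
    by rewrite ler_weXn2l// ltnW.
  by rewrite ler_wiXn2l.
apply: (@le_trans _ _ (K2 * x ^+ (2 * s1) * 2^-1 ^+ m)); last first.
  rewrite ler_wpM2r ?exprn_ge0 ?invr_ge0// ler_wpM2r ?exprn_ge0//.
  by rewrite lerDr.
rewrite /K2 [leRHS](_ : _ = (2 ^+ m0 * 2^-1 ^+ m) *
   ((3 * A * m0%:R) ^+ m0 * x ^+ (2 * s1))); last by ring.
rewrite ler_peMl//.
  by rewrite mulr_ge0 ?exprn_ge0// (le_trans _ c1).
by rewrite exprVn ler_pdivlMr ?exprn_gt0// mul1r ler_weXn2l ?ler1n// ltnW.
Qed.

(** Here [s] stands for [sqrt n]: the power is at most [e^(-M) <= e^(-s)], which beats [s^(-(j+2))];
    two of these powers pay for the prefactor [s^2]. *)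
Lemma superpoly_tail (R : realType) (B s y : R) (M j : nat) :
  1 <= s -> s <= M%:R -> 0 <= B * y -> B * y <= (expR 1)^-1 ->
  (1 + expR 1 * s ^+ 2) * (B * y) ^+ M
  <= (1 + expR 1) * ((j + 2)`!)%:R / s ^+ j.
Proof.
move=> s1 sM By0 Bye; have s0 : 0 < s by lra.
have e0 : 0 < expR 1 :> R by rewrite expR_gt0.
have pow : (B * y) ^+ M <= expR (- s).
  apply: (@le_trans _ _ ((expR 1)^-1 ^+ M)); first by rewrite lerXn2r ?nnegrE ?invr_ge0 ?(ltW e0).
  by rewrite -expRN -expRM_natl mulrN mulr1 ler_expR lerN2.
have fact_s : expR (- s) <= ((j + 2)`!)%:R / s ^+ (j + 2).
  rewrite expRN ler_pdivlMr ?exprn_gt0// mulrC ler_pdivrMr ?expR_gt0//.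
  by rewrite exprn_le_fact_expR// ltW.
apply: (@le_trans _ _ ((1 + expR 1) * s ^+ 2 * (((j + 2)`!)%:R / s ^+ (j + 2)))).
  rewrite ler_pM ?exprn_ge0 ?(le_trans pow)//.
    by rewrite addr_ge0 ?mulr_ge0 ?exprn_ge0 ?(ltW e0) ?(ltW s0).
  by rewrite mulrDl mul1r lerD2r exprn_ege1.
rewrite exprD le_eqVlt; apply/orP; left; apply/eqP; field.
by rewrite expf_neq0 gt_eqF.
Qed.

Lemma sum_half_le2 (R : realType) (a N : nat) : \sum_(a <= m < N) 2^-1 ^+ m <= 2 :> R.
Proof.
have geom M : \sum_(0 <= m < M) 2^-1 ^+ m = 2 - 2 * 2^-1 ^+ M :> R.
  elim: M => [|M IH]; first by rewrite big_geq// expr0 mulr1 subrr.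
  rewrite big_nat_recr//= IH exprS; set h := _ ^+ M; lra.
have [aN|Na] := leqP a N; last by rewrite big_geq// ltnW.
apply: (@le_trans _ _ (\sum_(0 <= m < N) 2^-1 ^+ m)).
  by rewrite (@big_cat_nat _ _ _ a 0)//= lerDr sumr_ge0// => m _; rewrite exprn_ge0.
by rewrite geom gerBl mulr_ge0// exprn_ge0.
Qed.

Lemma sqrt_log_decay (R : realType) (L s M : R) : 0 < L -> s = expR (L / 2) ->
  0 <= M <= 2 * s -> Num.sqrt M * (L / s) <= 28 / L.
Proof.
move=> L0 sE /andP[M0 Ms]; have s0 : 0 < s by rewrite sE expR_gt0.
(* [384 = 2^4 * 4!], from [(L/2)^4 <= 4! e^(L/2)]. The constant 28 then works because
   [2 * 384 = 768 <= 28^2]. *)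
have h : L ^+ 4 <= 384 * s.
  have := @exprn_le_fact_expR R (L / 2) 4; rewrite -sE expr_div_n divr_ge0 ?(ltW L0)// => /(_ isT).
  by rewrite !factS fact0 ler_pdivrMr ?exprn_gt0//; lra.
rewrite -(@ler_pXn2r _ 2) ?nnegrE ?(mulr_ge0, invr_ge0, sqrtr_ge0, ltW L0, ltW s0)//.
rewrite exprMn sqr_sqrtr// !expr_div_n.
apply: (@le_trans _ _ (2 * s * (L ^+ 2 / s ^+ 2))).
  by rewrite ler_wpM2r// divr_ge0 ?exprn_ge0 ?(ltW L0) ?(ltW s0).
rewrite ler_pdivlMr ?exprn_gt0//.
rewrite [leLHS](_ : _ = 2 * L ^+ 4 / s); last by field; rewrite gt_eqF.
rewrite ler_pdivrMr//; lra.
Qed.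

(** [Snk_expansion] at radius [r = sqrt (M / n)]. As [lambda <= M], every loss of the form
    [e^(O(lambda))] is at most [e^(O(M))]: the exponents are 1 from [(1 + r^2)^n], [e] from the
    signs dropped, and 2 from dividing by [(1 - q)^k]. *)
Lemma norm_remainder_le (R : realType) (n k M : nat)
  (L := ln (n%:R : R)) (s := Num.sqrt (n%:R : R)) (l := lambda R n k) :
  (0 < k)%N -> (k <= n)%N -> n%:R <= k%:R * L -> l / k%:R <= 4^-1 ->
  l <= M%:R -> (0 < M <= n)%N ->
  `|Snk R n k / (1 - l / k%:R) ^+ k -
      \sum_(m < M) tcoef R n m / k%:R ^+ m * Qbar R n k m|
  <= (1 + expR 1 * n%:R) *
     (expR (3 + expR 1) * (Num.sqrt M%:R * (L / s))) ^+ M.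
Proof.
move=> k0 kn nk q4 lM /andP[M0 Mn].
have MR : (0 : R) < M%:R by rewrite ltr0n.
have kR : (0 : R) < k%:R by rewrite ltr0n.
have nR : (0 : R) < n%:R by rewrite ltr0n (leq_trans M0).
have sM0 : 0 < Num.sqrt (M%:R : R) by rewrite sqrtr_gt0.
have s0 : 0 < s by rewrite sqrtr_gt0.
have sE : s ^+ 2 = n%:R by rewrite sqr_sqrtr// ltW.
have sME : Num.sqrt (M%:R : R) ^+ 2 = M%:R by rewrite sqr_sqrtr// ltW.
have e0 : 0 < expR 1 :> R by rewrite expR_gt0.
have l0 : 0 < l by rewrite /l /lambda mulr_gt0// expR_gt0.
have lk : l < k%:R.
  by rewrite (@le_lt_trans _ _ (4^-1 * k%:R)) -?ler_pdivrMr//; lra.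
pose r : R := Num.sqrt M%:R / s.
have r0 : 0 < r by rewrite divr_gt0.
have r1 : r <= 1 by rewrite ler_pdivrMr// mul1r ler_sqrt ?ler_nat// ltW.
have r01 : 0 < r <= 1 by rewrite r0.
have := @Snk_expansion R n k M r k0 kn lk r01.
rewrite -/l; set q := l / k%:R => main.
have q0 : 0 <= q by rewrite divr_ge0// ltW.
have {}q4 : q <= 4^-1 := q4.
have q1 : 0 < 1 - q by lra.
have kq : k%:R * q = l by rewrite /q mulrC divfK// gt_eqF.
have qk0 : 0 < (1 - q) ^+ k by rewrite exprn_gt0.
set S := \sum_(m < M) _ in main *.
have -> : Snk R n k / (1 - q) ^+ k - S = (Snk R n k - (1 - q) ^+ k * S) / (1 - q) ^+ k.
  by field; rewrite gt_eqF.
rewrite normrM [X in _ * X]ger0_norm ?invr_ge0 ?(ltW qk0)//.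
rewrite ler_pdivrMr// (le_trans main)//.
have e1 : (1 + r ^+ 2) ^+ n <= expR 1 ^+ M.
  apply: le_trans (exprn_1D_le_expR _ _ _ _) _; first by rewrite addr_ge0 ?exprn_ge0 ?(ltW r0).
  rewrite -expRM_natl mulr1 ler_expR /r expr_div_n sE sME.
  by rewrite mulrCA mulfV ?mulr1 ?gt_eqF.
have e2 : (M`!)%:R / (r * k%:R) ^+ M <= (Num.sqrt M%:R * (L / s)) ^+ M.
  have rk : 0 < r * k%:R by rewrite mulr_gt0.
  rewrite ler_pdivrMr ?exprn_gt0// -exprMn.
  apply: (@le_trans _ _ (M%:R ^+ M)); first by rewrite -natrX ler_nat fact_le_expn.
  have ME : M%:R <= Num.sqrt M%:R * (L / s) * (r * k%:R).
    rewrite /r [leRHS](_ : _ = Num.sqrt M%:R ^+ 2 * (k%:R * L / s ^+ 2)); last first.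
      by field; rewrite gt_eqF.
    by rewrite sME sE ler_peMr ?(ltW MR)// ler_pdivlMr// mul1r.
  by rewrite lerXn2r ?nnegrE ?(le_trans _ ME) ?(ltW MR).
have e3 : (1 + q * expR 1) ^+ k <= expR (expR 1) ^+ M.
  apply: le_trans (exprn_1D_le_expR _ _ _ _) _.
    by rewrite addr_ge0 ?mulr_ge0 ?(ltW e0).
  by rewrite -expRM_natl ler_expR mulrA kq ler_wpM2r ?(ltW e0).
(* [(1 - q)(1 + 2 q) >= 1] holds for [q <= 1/4]. *)
have e4 : 1 <= (1 - q) ^+ k * expR 2 ^+ M.
  apply: (@le_trans _ _ ((1 - q) ^+ k * (1 + 2 * q) ^+ k)).
    by rewrite -exprMn exprn_ege1//; nra.
  rewrite ler_wpM2l ?(ltW qk0)//.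
  apply: le_trans (exprn_1D_le_expR _ _ _ _) _; first by rewrite addr_ge0 ?mulr_ge0.
  by rewrite -expRM_natl ler_expR mulrCA kq mulrC ler_wpM2r.
rewrite (_ : 3 + expR 1 = 1 + expR 1 + 2); last by lra.
rewrite (expRD (1 + expR 1)) (expRD 1) [X in _ <= _ * X * _]exprMn.
rewrite [X in _ <= _ * (X * _) * _]exprMn.
rewrite [X in _ <= _ * (X * _ * _) * _]exprMn.
set c := 1 + _; have c0 : 0 <= c by rewrite /c addr_ge0 ?mulr_ge0 ?(ltW e0).
apply: (@le_trans _ _ (c * expR 1 ^+ M * (Num.sqrt M%:R * (L / s)) ^+ M * expR (expR 1) ^+ M)).
  have rr : 0 <= 1 + r ^+ 2 by rewrite addr_ge0 ?exprn_ge0 ?(ltW r0).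
  have qe : 0 <= 1 + q * expR 1 by rewrite addr_ge0 ?mulr_ge0 ?(ltW e0).
  apply: ler_pM => //.
  - rewrite !mulr_ge0 ?exprn_ge0 ?invr_ge0 ?exprn_ge0//.
    by rewrite mulr_ge0 ?ltW.
  - by rewrite exprn_ge0.
  apply: ler_pM => //.
  - by rewrite mulr_ge0// exprn_ge0.
  - by rewrite divr_ge0// exprn_ge0// mulr_ge0 ?ltW.
  by rewrite ler_wpM2l.
rewrite [leRHS](_ : _ = c * expR 1 ^+ M * (Num.sqrt M%:R * (L / s)) ^+ M * expR (expR 1) ^+ M
    * ((1 - q) ^+ k * expR 2 ^+ M)); last by ring.
rewrite ler_peMr// !mulr_ge0 ?exprn_ge0 ?(ltW e0) ?expR_ge0//.
have L0 : 0 <= L by rewrite -(pmulr_rge0 _ kR) (le_trans _ nk)// ltW.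
by rewrite mulr_ge0 ?divr_ge0// ltW.
Qed.

(** * The normalized error: large [n], then all [n] *)

Definition Snk_error (R : realType) (s1 n k : nat) : R :=
  Snk R n k / (1 - lambda R n k / k%:R) ^+ k - 1 -
  \sum_(2 <= m < 2 * s1) tau R m n / ((m`!)%:R * k%:R ^+ m) * Qbar R n k m.

Lemma Snk_error_large (R : realType) (s1 : nat) : (0 < s1)%N ->
  exists Y C : R, forall n k : nat, (0 < n)%N -> (0 < k)%N ->
    n%:R / lambertW (n%:R : R) <= k%:R <= 2 * n%:R / (ln (n%:R : R) + 6) ->
    Y <= ln (n%:R : R) ->
    `|Snk_error R s1 n k| <=
      C * (lambda R n k * ln (n%:R : R) / Num.sqrt (n%:R : R)) ^+ (2 * s1).
Proof.
move=> s1_gt0; have e0 : 0 < expR 1 :> R by rewrite expR_gt0.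
pose A : R := expR 1 * expR (expR 1); pose B : R := expR (3 + expR 1).
have A1 : 1 <= A by rewrite /A -expRD -expR0 ler_expR addr_ge0 ?expR_ge0.
have B0 : 0 < B by rewrite expR_gt0.
have Be0 : 0 < B * expR 1 by rewrite mulr_gt0.
have [d [K [d0 K0 term]]] := @geometric_term R A s1 A1.
(* The first summand brings [28 / L] below [d], the second makes the base of the remainder at most
   [1/e], and the others give [2 s1 <= M] and [s >= 3]. *)
exists (28 / d + 28 * (B * expR 1) + 4 * s1%:R + 4).
exists (2 * K + (1 + expR 1) * ((2 * s1 + 2)`!)%:R) => n k n0 k0 range.
set L := ln _ => YL; set s := Num.sqrt _; set l := lambda R n k.
have lrange := range; rewrite range_lambdaE// in lrange.
have /andP[_ kle] := range; have /andP[l1 _] := lrange.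
have [[L0 kn nk q4] [ls x1]] := @range_facts R n k n0 k0 kle lrange.
rewrite -/L in L0 nk; rewrite -/l in l1 q4; rewrite -/l -/s in ls; rewrite -/l -/L -/s in x1.
have nR : (0 : R) < n%:R by rewrite ltr0n.
have d28 : 0 < 28 / d by rewrite divr_gt0.
have s1R : (1 : R) <= s1%:R by rewrite ler1n.
have sexp : s = expR (L / 2).
  by rewrite /s -powR12_sqrt ?(ltW nR)// /powR gt_eqF// mulrC.
have sL : 1 + L / 2 <= s by rewrite sexp expR_ge1Dx.
have s3 : 3 <= s by lra.
have s0 : 0 < s by lra.
have sn : s * s = n%:R by rewrite -expr2 sqr_sqrtr// ltW.
(* Just above [sqrt n], hence above [lambda], yet at most [2 s], so that [sqrt M * L / s] still
   tends to 0. *)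
pose M := (Num.truncn s).+1.
have sM : s <= M%:R by rewrite ltW// truncnS_gt.
have Ms : M%:R <= s + 1 by rewrite -natr1 lerD2r truncn_le ltW.
have M2s : M%:R <= 2 * s by lra.
have Mn : (M <= n)%N by rewrite -(ler_nat R) -sn; nra.
have s1M : (2 * s1 <= M)%N by rewrite -(ler_nat R) natrM; lra.
have decay m : (m <= M)%N -> Num.sqrt (m%:R : R) * (L / s) <= 28 / L.
  move=> mM; apply: sqrt_log_decay => //.
  by rewrite ler0n/= (le_trans _ M2s)// ler_nat.
have decay_d : 28 / L <= d.
  by rewrite ler_pdivrMr// mulrC -ler_pdivrMr//; lra.
have decay_B : 28 / L <= (B * expR 1)^-1.
  by rewrite ler_pdivrMr// ler_pdivlMl//; lra.
set x := l * L / s in x1 *.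
have Lsx : 0 <= L / s <= x.
  rewrite divr_ge0 ?(ltW L0) ?(ltW s0)//= /x -mulrA ler_peMl//.
  by rewrite divr_ge0 ?(ltW L0) ?(ltW s0).
have x0 : 0 <= x by case/andP: Lsx => /le_trans; apply.
pose T m := tcoef R n m / k%:R ^+ m * Qbar R n k m.
have -> : Snk_error R s1 n k =
    (Snk R n k / (1 - l / k%:R) ^+ k - \sum_(m < M) T m)
    + \sum_(2 * s1 <= m < M) T m.
  rewrite /Snk_error -(big_mkord predT T) (@big_cat_nat _ _ _ (2 * s1) 0)//=.
  rewrite (@big_cat_nat _ _ _ 2 0)//=; last by rewrite leq_pmulr.
  rewrite [\sum_(0 <= m < 2) _]big_nat_recl// big_nat1.
  rewrite /T tcoefn0 tcoefn1 Qbar0 expr0 divr1 mul1r !mul0r addr0.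
  have -> : \sum_(2 <= m < 2 * s1) tau R m n / ((m`!)%:R * k%:R ^+ m) * Qbar R n k m =
     \sum_(2 <= m < 2 * s1) tcoef R n m / k%:R ^+ m * Qbar R n k m.
    by apply: eq_bigr => m _; rewrite /tcoef invfM mulrA.
  rewrite -/l; ring.
apply: (le_trans (ler_normD _ _)); rewrite addrC mulrDl; apply: lerD.
  apply: (le_trans (ler_norm_sum _ _ _)).
  apply: (@le_trans _ _ (\sum_(2 * s1 <= m < M) K * x ^+ (2 * s1) * 2^-1 ^+ m)).
    rewrite big_nat_cond [leRHS]big_nat_cond; apply: ler_sum => m.
    rewrite andbT => /andP[sm mM].
    have m0 : (0 < m)%N by rewrite (leq_trans _ sm)// muln_gt0.
    have mn : (0 < m <= n)%N by rewrite m0 (leq_trans (ltnW mM)).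
    apply: le_trans (norm_term_le R n k m k0 mn nk q4) _.
    by apply: term => //; apply: le_trans (decay _ (ltnW mM)) decay_d.
  rewrite -mulr_sumr [leRHS](_ : _ = K * x ^+ (2 * s1) * 2); last by ring.
  by rewrite ler_wpM2l ?sum_half_le2// mulr_ge0 ?exprn_ge0.
have Mpos : (0 < M <= n)%N by rewrite Mn.
apply: le_trans (@norm_remainder_le R n k M k0 kn nk q4 (le_trans ls sM) Mpos) _.
have sq0 : 0 <= Num.sqrt (M%:R : R) * (L / s).
  by rewrite mulr_ge0 ?sqrtr_ge0//; case/andP: Lsx.
rewrite -/L -/s -/B -sn -expr2.
apply: le_trans (@superpoly_tail R B s (Num.sqrt M%:R * (L / s)) M (2 * s1) _ _ _ _) _ => //.
- lra.
- by rewrite mulr_ge0 ?(ltW B0).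
- rewrite -ler_pdivlMl//; apply: (le_trans (decay M (leqnn M))).
  by rewrite -invfM.
(* The remainder is [O(s^(-2 s1))], and [1 / s <= x] because [lambda] and [L] are at least 1. *)
rewrite ler_wpM2l ?mulr_ge0 ?addr_ge0 ?(ltW e0)// -exprVn lerXn2r ?nnegrE ?invr_ge0 ?(ltW s0)//.
rewrite /x -[leLHS]mul1r ler_wpM2r ?invr_ge0 ?(ltW s0)//; nra.
Qed.

Lemma Snk_error_bound (R : realType) (s1 : nat) : (0 < s1)%N ->
  exists C : R, forall n k : nat, (0 < n)%N -> (0 < k)%N ->
    n%:R / lambertW (n%:R : R) <= k%:R <= 2 * n%:R / (ln (n%:R : R) + 6) ->
    `|Snk_error R s1 n k| <=
      C * (lambda R n k * ln (n%:R : R) / Num.sqrt (n%:R : R)) ^+ (2 * s1).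
Proof.
move=> s1_gt0; have [Y [C large]] := Snk_error_large R s1 s1_gt0.
pose N := (Num.truncn (expR Y)).+1.
pose x n k : R := lambda R n k * ln n%:R / Num.sqrt n%:R.
(* Below the threshold [k <= n < N] leaves finitely many pairs; [c] is the constant that each
   requires. The absolute value in the denominator makes every [c i j] nonnegative, so the full sum
   dominates each entry. *)
pose c (i j : 'I_N) : R := `|Snk_error R s1 i j| / `|x i j| ^+ (2 * s1).
have c0 i j : 0 <= c i j by rewrite divr_ge0// exprn_ge0.
exists (`|C| + \sum_(i < N) \sum_(j < N) c i j) => n k n0 k0 range.
rewrite -/(x n k); have lrange := range; rewrite range_lambdaE// in lrange.
have /andP[_ kle] := range; have /andP[l1 _] := lrange.
have [[L0 kn _ _] _] := @range_facts R n k n0 k0 kle lrange.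
have nR : (0 : R) < n%:R by rewrite ltr0n.
have x0 : 0 < x n k.
  by rewrite /x divr_gt0 ?sqrtr_gt0// mulr_gt0// (lt_le_trans ltr01).
have [YL|LY] := leP Y (ln (n%:R : R)).
  rewrite (le_trans (large n k n0 k0 range YL))// ler_wpM2r ?exprn_ge0 ?(ltW x0)//.
  by rewrite (le_trans (ler_norm C))// lerDl sumr_ge0// => i _; rewrite sumr_ge0.
have nN : (n < N)%N.
  rewrite -(ltr_nat R) (lt_trans _ (truncnS_gt _))//.
  by rewrite -[X in X < _](lnK (nR : n%:R \is Num.pos)) ltr_expR.
have kN : (k < N)%N := leq_ltn_trans kn nN.
rewrite -ler_pdivrMr ?exprn_gt0// -[x n k]ger0_norm ?(ltW x0)//.
rewrite (bigD1 (Ordinal nN))//= (bigD1 (Ordinal kN))//= /c /=.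
rewrite addrCA -addrA lerDl addr_ge0 ?addr_ge0 ?sumr_ge0// => i _; rewrite ?sumr_ge0 ?c0//.
Qed.

Theorem theorem4 (R : realType) :
  (forall n k : nat, (0 < n)%N -> (0 < k)%N ->
     (n%:R / lambertW (n%:R : R) <= k%:R <= 2 * n%:R / (ln (n%:R : R) + 6)
      <->
      1 <= lambda R n k
        <= 2 / expR 3 * (Num.sqrt (n%:R : R) / (ln (n%:R : R) + 6))))
  /\
  (forall s1 : nat, (1 <= s1)%N ->
   exists C : R, forall n k : nat, (0 < n)%N -> (0 < k)%N ->
     n%:R / lambertW (n%:R : R) <= k%:R <= 2 * n%:R / (ln (n%:R : R) + 6) ->
     exists E : R,
       `|E| <= C * (lambda R n k * ln (n%:R : R) / Num.sqrt (n%:R : R))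
                     ^+ (2 * s1)
       /\
       Snk R n k =
         (1 - lambda R n k / k%:R) ^+ k *
         (1 + \sum_(2 <= m < 2 * s1)
                tau R m n / ((m`!)%:R * k%:R ^+ m) * Qbar R n k m
            + E)).
Proof.
split=> [n k n0 k0|s1 s1_gt0]; first by rewrite range_lambdaE.
have [C bound] := Snk_error_bound R s1 s1_gt0.
exists C => n k n0 k0 range; exists (Snk_error R s1 n k); split; first exact: bound.
have lrange := range; rewrite range_lambdaE// in lrange; have /andP[_ kle] := range.
have [[_ _ _ q4] _] := @range_facts R n k n0 k0 kle lrange.
have q1 : (1 - lambda R n k / k%:R) ^+ k != 0.
  by rewrite expf_neq0// gt_eqF//; lra.
have cancel_sum (a b c : R) : a + b + (c - a - b) = c by ring.
by rewrite /Snk_error cancel_sum mulrC divfK.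
Qed.
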